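(* Let $V$ be a Euclidean vector space, $B\in\mathrm{End}(V)$ symmetric, and let $c,d\in \mathrm{C}\ell(V)$ be invariant with respect to $\mathfrak{so}_B(V)$. Then $\Omega_{c,d}\in\mathfrak{so}_B(V)\otimes \mathrm{C}\ell(V)$ if and only if $c$ and $d$, expanded in an orthonormal basis adapted to the eigenspace decomposition of $V$ with respect to $B$, are of the following form with complex scalars $c_\alpha,\hat c_\alpha,d_\alpha,\hat d_\alpha$: (a) if $B=\lambda\,\mathrm{id}_V$: $c=c_0+\hat c_0\Gamma^*$, $d=d_0+\hat d_0\Gamma^*$; (b) if the number of different eigenvalues of $B$ is two: $$c=(c_0+\hat c_0\Gamma^* )+(c_1+\hat c_1\Gamma^* )\Gamma_{I_1},\qquad d=(c_0-(-1)^{\dim V}\hat c_0\Gamma^* )+(d_1+\hat d_1\Gamma^* )\Gamma_{I_1};$$ (c) if the number of different eigenvalues of $B$ exceeds two: $$c=(c_0+\hat c_0\Gamma^* )+\sum_\alpha(c_\alpha+\hat c_\alpha\Gamma^* )\Gamma_{I_\alpha},\qquad d=(c_0-(-1)^{\dim V}\hat c_0\Gamma^* )+\sum_\alpha(-1)^{\hat I_\alpha}\big(c_\alpha-(-1)^{\dim V}\hat c_\alpha\Gamma^*\big)\Gamma_{I_\alpha}.$$ If $\dim V$ is odd one may choose $\hat c_\alpha=\hat d_\alpha=0$ because $\Gamma^*=\pm1$.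
   Context: $V$ is an $n$-dimensional real vector space with Euclidean metric $g$; $\mathrm{C}\ell(V)$ is its complex Clifford algebra with $vw+wv=-2g(v,w)$, identified with $\mathrm{End}(S)$ for an irreducible module $S$ (so that $\Gamma^*=\pm1$ for odd $n$). $\Gamma^*=i^{\lfloor (n+1)/2\rfloor}\Gamma_1\cdots\Gamma_n$ for the Clifford generators $\Gamma_\mu$ of an orthonormal basis. $\mathfrak{so}_B(V)=\{A\in\mathfrak{so}(V)\,|\,[A,B]=0\}$, identified via $g$ with a space of skew-symmetric bilinear forms, $\mathfrak{so}_B(V)\subset\Lambda^2V^*\subset V^*\otimes V^*$; it is also viewed inside the span of the $\Gamma_\mu\Gamma_\nu$ ($\mu\ne\nu$) in $\mathrm{C}\ell(V)$ via the spin representation ($[A,x]=A(x)$ for $x\in V$), and $c\in \mathrm{C}\ell(V)$ is invariant with respect to $\mathfrak{so}_B(V)$ if $[A,c]=0$ for all $A\in\mathfrak{so}_B(V)$. With $s_{a,b}(x)=ax-xb$, $\Omega_{c,d}\in V^*\otimes V^*\otimes \mathrm{C}\ell(V)$ is defined by $\Omega_{c,d}(v,w)=s_{d,c}(v)\,w+w\,s_{c,d}(v)$ for $v,w\in V$. Let $V=\bigoplus_{\alpha=1}^rV_\alpha$ be the decomposition into the eigenspaces of $B$ for its distinct eigenvalues, and take an orthonormal basis of $V$ that is the union of orthonormal bases of the $V_\alpha$; $\Gamma_{I_\alpha}$ is the product of the generators belonging to the basis of $V_\alpha$, and $\hat I_\alpha=\dim V_\alpha$. *)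

(* Defs.v *)
From mathcomp Require Import all_boot all_order all_algebra reals.
From mathcomp.real_closed Require Import complex.

Set Implicit Arguments.
Unset Strict Implicit.
Unset Printing Implicit Defensive.

Import Order.TTheory GRing.Theory Num.Theory.
Import passmx.

#[global] Open Scope ring_scope.
#[global] Open Scope complex_scope.

Section CliffordModule.
Variables (R : realType) (V : vectType R) (g : {dot V for idfun}) (N : nat).

(* The complex Clifford algebra is represented as 'M[R[i]]_N = End(S), where
   S = 'cV[R[i]]_N is an irreducible Clifford module and gam v is the
   endomorphism by which v acts. *)
Record clifford_map (gam : V -> 'M[R[i]]_N) : Prop := CliffordMap {
  clifford_mapD : forall v w, gam (v + w) = gam v + gam w;
  clifford_mapZ : forall (a : R) v, gam (a *: v) = a%:C *: gam v;
  clifford_mapM : forall v w,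
    gam v * gam w + gam w * gam v = (- (2 * g v w))%:C%:M
}.

Definition irreducible_module (gam : V -> 'M[R[i]]_N) : Prop :=
  (0 < N)%N /\
  forall U : {vspace 'cV[R[i]]_N},
    (forall v s, s \in U -> gam v *m s \in U) -> U = 0%VS \/ U = fullv.

End CliffordModule.

Section EigenspaceData.
Variables (R : realType) (V : vectType R) (g : {dot V for idfun}).
Variable B : 'End(V).

Definition g_symmetric : Prop := forall v w, g (B v) w = g v (B w).

Definition soB (A : 'End(V)) : Prop :=
  (forall v w, g (A v) w = - g v (A w)) /\ (A \o B)%VF = (B \o A)%VF.

Definition spectrum (s : seq R) : Prop :=
  uniq s /\ forall a : R, leigenvalue B a = (a \in s).

Definition orthonormal_basis (U : {vspace V}) (X : seq V) : Prop :=
  basis_of U X /\ orthonormal g X.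

(* The orthonormal basis e of V is a union of orthonormal bases of the
   eigenspaces; no ordering of e by eigenspace is imposed. *)
Definition adapted_basis n (e : n.-tuple V) : Prop :=
  [/\ orthonormal_basis fullv e,
      forall i : 'I_n, exists a : R, tnth e i \in leigenspace B a &
      forall a : R,
        orthonormal_basis (leigenspace B a) [seq x <- e | x \in leigenspace B a]].

End EigenspaceData.

Section CliffordElements.
Variables (R : realType) (V : vectType R) (g : {dot V for idfun}).
Variables (B : 'End(V)) (N : nat) (gam : V -> 'M[R[i]]_N).
Variables (n : nat) (e : n.-tuple V).

Local Notation Cl := 'M[R[i]]_N.

Definition Gam (m : 'I_n) : Cl := gam (tnth e m).

Definition Gam_star : Cl := 'i ^+ (n.+1)./2 *: \prod_(m < n) Gam m.

Definition Gam_eigen (a : R) : Cl :=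
  \prod_(m < n | tnth e m \in leigenspace B a) Gam m.

(* The image in Cl(V) of a skew A; see spin_rep_comm for [A, x] = A(x). *)
Definition spin_rep (A : 'End(V)) : Cl :=
  4^-1 *: \sum_(m < n) \sum_(k < n | m != k)
    (g (A (tnth e m)) (tnth e k))%:C *: (Gam m * Gam k).

Definition soB_invariant (c : Cl) : Prop :=
  forall A, soB g B A -> spin_rep A * c = c * spin_rep A.

Definition s_map (a b : Cl) (x : V) : Cl := a * gam x - gam x * b.

Definition Omega (c d : Cl) (v w : V) : Cl :=
  s_map d c v * gam w + gam w * s_map c d v.

(* Elements of V^* (x) V^* (x) Cl(V) are bilinear maps V x V -> Cl(V); those in
   so_B(V) (x) Cl(V) are the finite sums of A_k (x) x_k, where A in so_B(V) is
   identified with the skew form (v, w) |-> g (A v) w. *)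
Definition in_soB_tensor_Cl (W : V -> V -> Cl) : Prop :=
  exists (p : nat) (A : 'I_p -> 'End(V)) (x : 'I_p -> Cl),
    (forall k, soB g B (A k)) /\
    forall v w, W v w = \sum_(k < p) (g (A k v) w)%:C *: x k.

Definition cplx2 (a ah : R[i]) : Cl := a%:M + ah *: Gam_star.

Definition form_a (c d : Cl) (c0 ch0 d0 dh0 : R[i]) : Prop :=
  c = cplx2 c0 ch0 /\ d = cplx2 d0 dh0.

(* a1 is the eigenvalue labelled 1 *)
Definition form_b (a1 : R) (c d : Cl) (c0 ch0 c1 ch1 d1 dh1 : R[i]) : Prop :=
  c = cplx2 c0 ch0 + cplx2 c1 ch1 * Gam_eigen a1 /\
  d = cplx2 c0 (- ((-1) ^+ n * ch0)) + cplx2 d1 dh1 * Gam_eigen a1.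

Definition form_c r (lam : r.-tuple R) (c d : Cl)
    (c0 ch0 : R[i]) (cc ch : 'I_r -> R[i]) : Prop :=
  c = cplx2 c0 ch0
      + \sum_(al < r) cplx2 (cc al) (ch al) * Gam_eigen (tnth lam al) /\
  d = cplx2 c0 (- ((-1) ^+ n * ch0))
      + \sum_(al < r) (-1) ^+ (\dim (leigenspace B (tnth lam al)))
          *: (cplx2 (cc al) (- ((-1) ^+ n * ch al))
              * Gam_eigen (tnth lam al)).

End CliffordElements.

Section SpinRep.
Variables (R : realType) (V : vectType R) (g : {dot V for idfun}).
Variables (N : nat) (gam : V -> 'M[R[i]]_N).
Hypothesis Hgam : clifford_map g gam.
Variables (n : nat) (e : n.-tuple V).
Hypothesis He : orthonormal_basis g fullv e.

Local Lemma gC u v : g u v = g v u.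
Proof. by rewrite hermC /= expr0 mul1r. Qed.

Lemma orthonormal_basisE (m k : 'I_n) : g (tnth e m) (tnth e k) = (m == k)%:R.
Proof.
case: He => Hb /andP[/allP H1 H2].
have [->|] := eqVneq m k; first by apply/eqP/(H1 (tnth e k))/mem_tnth.
wlog lt_mk : m k / (m < k)%N => [IH ne|_].
  case: (ltngtP m k) => [lt|lt|/val_inj E]; first exact: IH.
    by rewrite gC; apply: IH; rewrite // eq_sym.
  by rewrite E eqxx in ne.
rewrite !(tnth_nth 0); move: m k lt_mk => [m lm] [k lk] /=.
have : (k < size e)%N by rewrite size_tuple.
elim: (val e) m k H2 {lm lk} => [|x s IH] [|m] [|k] //= /andP[Hx Hs] lk lt.
  by move: Hx; rewrite /ortho_rec /= andbT => /allP/(_ s`_k)/(_ (mem_nth _ _))/eqP->.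
exact: IH.
Qed.

Local Lemma g_suml m (F : 'I_m -> V) w : g (\sum_(k < m) F k) w = \sum_(k < m) g (F k) w.
Proof.
by apply: (big_morph (fun v => g v w)) => [x y|]; rewrite ?linearDl ?linear0l.
Qed.

Lemma orthonormal_coord (x : V) : x = \sum_(m < n) g x (tnth e m) *: tnth e m.
Proof.
have [Hb _] := He.
rewrite {1}(coord_basis Hb (memvf x)); apply: eq_bigr => k _.
rewrite (tnth_nth 0); congr (_ *: _).
rewrite {2}(coord_basis Hb (memvf x)) g_suml (bigD1 k) //= big1 => [|m ne].
  by rewrite linearZl_LR /= -!tnth_nth orthonormal_basisE eqxx mulr1 addr0.
by rewrite linearZl_LR /= -!tnth_nth orthonormal_basisE (negbTE ne) mulr0.
Qed.

Local Lemma gam_sum m (F : 'I_m -> V) : gam (\sum_(k < m) F k) = \sum_(k < m) gam (F k).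
Proof.
apply: (big_morph gam) => [x y|]; first exact: clifford_mapD Hgam x y.
by rewrite -(scale0r 0) (clifford_mapZ Hgam) !scale0r.
Qed.

Local Lemma mulZl (a : R[i]) (x y : 'M[R[i]]_N) : a *: (x * y) = (a *: x) * y.
Proof. exact: scalemxAl. Qed.

Local Lemma mulZr (a : R[i]) (x y : 'M[R[i]]_N) : a *: (x * y) = x * (a *: y).
Proof. exact: scalemxAr. Qed.

Lemma spin_rep_comm (A : 'End(V)) (x : V) :
  (forall v w, g (A v) w = - g v (A w)) ->
  spin_rep g gam e A * gam x - gam x * spin_rep g gam e A = gam (A x).
Proof.
move=> skA; have AZ a u : A (a *: u) = a *: A u by rewrite linearZ.
have gd m : g (A (tnth e m)) (tnth e m) = 0.
  have := skA (tnth e m) (tnth e m); rewrite [in RHS]gC => /eqP.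
  by rewrite -subr_eq0 opprK -mulr2n mulrn_eq0 /= => /eqP.
have rowE m : \sum_(k < n | m != k)
    (g (A (tnth e m)) (tnth e k))%:C *: (Gam gam e m * Gam gam e k)
    = Gam gam e m * gam (A (tnth e m)).
  rewrite [in RHS](orthonormal_coord (A (tnth e m))) gam_sum mulr_sumr.
  rewrite [RHS](bigD1 m) //= gd scale0r -(scale0r 0) (clifford_mapZ Hgam).
  rewrite scale0r mulr0 add0r; apply: eq_big => [k|k _]; first by rewrite eq_sym.
  by rewrite (clifford_mapZ Hgam) -mulZr.
rewrite /spin_rep (eq_bigr _ (fun m _ => rowE m)).
rewrite -mulZl -mulZr -scalerBr mulr_suml mulr_sumr -sumrB.
have comE u v : gam u * gam v * gam x - gam x * (gam u * gam v)
   = (- (2 * g v x))%:C *: gam u - (- (2 * g u x))%:C *: gam v.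
  have E w z : (w%:C *: gam z) = gam z * w%:C%:M by rewrite -scalemx1 -mulZr mulr1.
  have E' w z : (w%:C *: gam z) = w%:C%:M * gam z by rewrite -scalemx1 -mulZl mul1r.
  rewrite E E' -!(clifford_mapM Hgam) mulrDr mulrDl !mulrA.
  rewrite opprD addrA; congr (_ - _); by rewrite addrK.
under eq_bigr => m _ do rewrite comE.
rewrite sumrB.
have -> : \sum_(m < n) (- (2 * g (A (tnth e m)) x))%:C *: Gam gam e m = 2 *: gam (A x).
  rewrite [in RHS](orthonormal_coord (A x)) gam_sum scaler_sumr.
  apply: eq_bigr => m _; rewrite (clifford_mapZ Hgam) scalerA skA [g (A x) _]gC.
  by rewrite mulrN opprK rmorphM /= rmorph_nat.
have -> : \sum_(m < n) (- (2 * g (tnth e m) x))%:C *: gam (A (tnth e m)) = - (2 *: gam (A x)).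
  rewrite {2}(orthonormal_coord x) linear_sum gam_sum scaler_sumr -sumrN.
  apply: eq_bigr => m _; rewrite /= AZ [in RHS](clifford_mapZ Hgam).
  by rewrite scalerA [g x _]gC rmorphN rmorphM /= rmorph_nat scaleNr.
by rewrite opprK -scalerDl scalerA -natrD mulVf ?scale1r // pnatr_eq0.
Qed.

End SpinRep.

(* Main.v *)
(** Conjugations by the generators Gamma_m are commuting involutions of End(S),
    so c and d split into simultaneous eigenvectors, indexed by sign functions
    s; by Schur's lemma each joint eigenspace is spanned by a Clifford word
    (a product of generators) or is zero.  Invariance under so_B(V) says that
    only signs constant on the blocks V_alpha occur.  On basis vectors of two
    different blocks Omega must vanish, and on the components of sign s this
    reads d_s (1 + s_m s_k) = c_s (s_m + s_k): whenever two blocks carry the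
    same sign +-1, d_s = +-c_s.  With more than two blocks, a sign function
    taking both values at least twice forces c_s = d_s = 0; the remaining ones
    are constant or single out one block, which gives the words Gamma_star,
    Gamma_(I_alpha) and Gamma_star Gamma_(I_alpha). *)

From HB Require Import structures.
Require Import Defs.
From mathcomp Require Import all_boot all_order all_algebra reals.
From mathcomp.real_closed Require Import complex.

Import Order.TTheory GRing.Theory Num.Theory passmx.

Set Implicit Arguments.
Unset Strict Implicit.
Unset Printing Implicit Defensive.

(** * Boolean functions on a finite set *)

Lemma card_le1_cases (T : finType) (f : T -> bool) : (#|f| <= 1)%N ->
  (forall x, f x = false) \/ exists y, forall x, f x = (x == y).
Proof.
rewrite leq_eqVlt ltnS leqn0 => /orP[|] h; [right|left].
  by have /card1P[y yP] := h; exists y => x; have := yP x; rewrite !inE.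
by move=> x; have /card0_eq/(_ x) := eqP h.
Qed.

(** Each of the two fibres is compared with one element: an empty fibre makes [f] constant, a
    singleton is a single exceptional point, and otherwise both values are taken twice. *)
Lemma bool_fun_cases (T : finType) (f : T -> bool) :
  (exists t, forall x, f x = t) \/
  ((exists y t, forall x, f x = (x == y) (+) t) \/
   exists a1 a2 b1 b2, [/\ a1 != a2, b1 != b2,
     f a1 = true /\ f a2 = true & f b1 = false /\ f b2 = false]).
Proof.
have [/card_le1_cases[h|[y h]]|/card_gt1P[a1 [a2 [fa1 fa2 na]]]] := leqP #|f| 1.
- by left; exists false.
- by right; left; exists y, false => x; rewrite h addbF.
have [/card_le1_cases[h|[y h]]|/card_gt1P[b1 [b2 [fb1 fb2 nb]]]] :=
    leqP #|[pred x | ~~ f x]| 1.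
- by left; exists true => x; have /negbFE := h x.
- by right; left; exists y, true => x; rewrite addbT -h /= negbK.
right; right; exists a1, a2, b1, b2; split=> //.
by split; apply/negbTE; rewrite ?inE in fb1 fb2.
Qed.

(** * Clifford words and sign decompositions *)

Section CliffordGenerators.
Variables (C : numFieldType) (A : algType C) (n : nat) (G : 'I_n -> A).
Hypothesis G_sqr : forall m, G m * G m = -1.
Hypothesis G_anti : forall m k, m != k -> G m * G k = - (G k * G m).

(* Conjugation by [G m], since the inverse of [G m] is [- G m]. *)
Definition gconj (m : 'I_n) (x : A) : A := - (G m * x * G m).

Definition twisted (s : 'I_n -> bool) (x : A) : Prop :=
  forall m, gconj m x = (-1) ^+ s m *: x.

Lemma gconjD m x y : gconj m (x + y) = gconj m x + gconj m y.
Proof. by rewrite /gconj mulrDr mulrDl opprD. Qed.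

Lemma gconjZ m a x : gconj m (a *: x) = a *: gconj m x.
Proof. by rewrite /gconj -scalerAr -scalerAl scalerN. Qed.

Lemma gconj0 m : gconj m 0 = 0.
Proof. by rewrite /gconj mulr0 mul0r oppr0. Qed.

Lemma gconj1 m : gconj m 1 = 1.
Proof. by rewrite /gconj mulr1 G_sqr opprK. Qed.

Lemma gconjM m x y : gconj m (x * y) = gconj m x * gconj m y.
Proof.
by rewrite /gconj mulrNN !mulrA -(mulrA _ (G m) (G m)) G_sqr mulrN1 !mulNr.
Qed.

Lemma gconj_mulG m x : G m * x = gconj m x * G m.
Proof. by rewrite /gconj mulNr -(mulrA _ (G m) (G m)) G_sqr mulrN1 opprK. Qed.

Lemma gconjK m : involutive (gconj m).
Proof.
move=> x; rewrite /gconj mulrN mulNr opprK !mulrA G_sqr -!mulrA G_sqr.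
by rewrite mulN1r mulrN1 opprK.
Qed.

Lemma gconjC m k x : gconj m (gconj k x) = gconj k (gconj m x).
Proof.
have [->//|ne] := eqVneq m k; rewrite /gconj !mulrN !mulNr !opprK !mulrA.
by rewrite (G_anti ne) -!mulrA (G_anti ne) !mulrN !mulNr !mulrA.
Qed.

Lemma gconjG m k : gconj m (G k) = (-1) ^+ (m != k) *: G k.
Proof.
rewrite /gconj; have [->|ne] := eqVneq m k.
  by rewrite G_sqr mulN1r opprK expr0 scale1r.
by rewrite (G_anti ne) mulNr opprK -mulrA G_sqr mulrN1 expr1 scaleN1r.
Qed.

Lemma twisted0 s : twisted s 0.
Proof. by move=> m; rewrite gconj0 scaler0. Qed.

Lemma twistedZ s a x : twisted s x -> twisted s (a *: x).
Proof. by move=> h m; rewrite gconjZ h !scalerA mulrC. Qed.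

Lemma twisted1 : twisted (fun=> false) 1.
Proof. by move=> m; rewrite gconj1 expr0 scale1r. Qed.

Lemma twistedM s t x y :
  twisted s x -> twisted t y -> twisted (fun m => s m (+) t m) (x * y).
Proof.
move=> hx hy m; rewrite gconjM hx hy -scalerAl -scalerAr scalerA.
by rewrite -signr_addb.
Qed.

Lemma eq_twisted s t x : s =1 t -> twisted s x -> twisted t x.
Proof. by move=> e h m; rewrite -e. Qed.

Lemma signZ_neq_eq0 (b b' : bool) (x : A) :
  b != b' -> ((-1) ^+ b : C) *: x = (-1) ^+ b' *: x -> x = 0.
Proof.
move=> ne /eqP; rewrite -subr_eq0 -scalerBl scaler_eq0 => /orP[|/eqP//].
have N2 : (1 + 1 == 0 :> C) = false by rewrite -mulr2n pnatr_eq0.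
by case: b b' ne => [] [] //= _; rewrite ?expr0 ?expr1 ?opprK -?opprD ?oppr_eq0 N2.
Qed.

(** * Words in the generators and their signs *)

Definition word (l : seq 'I_n) : A := \prod_(m <- l) G m.

(** Conjugation by [G m] fixes [G m] and negates every other generator, so the sign counts the
    letters different from [m]. *)
Lemma word_twisted l :
  uniq l -> twisted (fun m => odd (size l) (+) (m \in l)) (word l).
Proof.
rewrite /word; elim: l => [|k l IH] /=.
  by move=> _; rewrite big_nil; apply: eq_twisted twisted1.
case/andP=> kl /IH h; rewrite big_cons.
apply: eq_twisted (twistedM (fun m => gconjG m k) h) => m.
rewrite inE; have [->|] := eqVneq m k; first by rewrite (negbTE kl) addbF addbT negbK.
by rewrite addbA addTb.
Qed.

Lemma word_comm s l x : twisted s x ->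
  word l * x = (-1) ^+ (\sum_(m <- l) s m)%N *: (x * word l).
Proof.
move=> hx; rewrite /word; elim: l => [|k l IH].
  by rewrite !big_nil mul1r mulr1 expr0 scale1r.
rewrite !big_cons -mulrA IH -scalerAr !mulrA (gconj_mulG k x) hx -!scalerAl scalerA.
by rewrite exprD mulrC.
Qed.

(** The exponent is 1 + 2 + ... + [size l]: the head letter contributes its own square and one sign
    for each remaining letter. *)
Lemma word_sqr l : uniq l -> word l * word l = (-1) ^+ 'C((size l).+1, 2) *: 1.
Proof.
elim: l => [|k l IH] /=; first by rewrite /word big_nil mulr1 expr0 scale1r.
case/andP=> kl ul; have hs := word_twisted ul k.
rewrite {1 2}/word !big_cons -/(word l).
have -> : G k * word l * (G k * word l) = - (gconj k (word l) * word l).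
  by rewrite /gconj mulNr opprK !mulrA.
rewrite hs (negbTE kl) addbF -scalerAl (IH ul) scalerA -scaleNr.
by rewrite signr_odd [in RHS]binS bin1 exprD exprS mulN1r mulrN mulrC.
Qed.

Definition volume : A := word (index_enum 'I_n).

Definition subword (P : pred 'I_n) : A := \prod_(m < n | P m) G m.

Lemma size_ord_enum : size (index_enum 'I_n) = n.
Proof. by rewrite -sum1_size sum1_card card_ord. Qed.

Lemma subwordE P : subword P = word [seq m <- index_enum 'I_n | P m].
Proof. by rewrite /subword /word big_filter. Qed.

Lemma subword_twisted P : twisted (fun m => odd #|P| (+) P m) (subword P).
Proof.
rewrite subwordE; have u := filter_uniq P (index_enum_uniq 'I_n).
apply: eq_twisted (word_twisted u) => m.
by rewrite mem_filter mem_index_enum andbT -sum1_size big_filter sum1_card.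
Qed.

Lemma volume_twisted : twisted (fun=> ~~ odd n) volume.
Proof.
apply: eq_twisted (word_twisted (index_enum_uniq _)) => m.
by rewrite size_ord_enum mem_index_enum addbT.
Qed.

(** By [word_comm], this parity decides whether [volume] commutes or anticommutes with an element of
    signs [P m (+) t]. *)
Lemma odd_sum_addb (P : pred 'I_n) t :
  odd (\sum_(m < n) (P m (+) t))%N = odd #|P| (+) (t && odd n).
Proof.
rewrite (big_morph odd oddD (erefl _)).
under eq_bigr => m _ do rewrite oddb.
rewrite big_split /=; congr (_ (+) _).
  rewrite -sum1_card (big_morph odd oddD (erefl _)) [RHS]big_mkcond /=.
  by apply: eq_bigr => m _; rewrite unfold_in; case: (P m).
case: t => /=; last by rewrite big1.
by rewrite -[in RHS](card_ord n) -sum1_card (big_morph odd oddD (erefl _)).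
Qed.

(** * Joint eigenspaces under Schur's lemma *)

Section Schur.
Hypothesis schur : forall x, twisted (fun=> false) x -> exists a : C, x = a *: 1.
Variable z : C.
Hypothesis z_neq0 : z != 0.
(** Becomes [Gam_star] when [z] is the power of ['i] in its definition. *)
Local Notation gs := (z *: volume).

(** The signs of [x * y] cancel, so it is a scalar by [schur]; multiplying by [y] once more recovers
    [x] up to the factor [q]. *)
Lemma twisted_scale s x y (q : C) : q != 0 -> y * y = q *: 1 ->
  twisted s x -> twisted s y -> exists a : C, x = a *: y.
Proof.
move=> q0 yy hx hy; have [|a xy] := schur (x := x * y).
  by apply: eq_twisted (twistedM hx hy) => m; rewrite addbb.
exists (q^-1 * a); have : q *: x = a *: y.
  by rewrite -[q *: x]mulr1 -scalerAl scalerAr -yy mulrA xy -scalerAl mul1r.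
by move=> e; rewrite -scalerA -e scalerA mulVf // scale1r.
Qed.

(** In odd dimension [volume] is a scalar by [schur], nonzero because its square is a sign. It
    therefore commutes with [x], whereas the odd number of minus signs makes it anticommute. *)
Lemma odd_twisted_eq0 (s : 'I_n -> bool) x :
  odd n -> odd (\sum_(m < n) s m)%N -> twisted s x -> x = 0.
Proof.
move=> on os hx; have [|a va] := schur (x := volume).
  by apply: eq_twisted volume_twisted => m; rewrite on.
have := word_comm (index_enum 'I_n) hx; rewrite -/volume va -signr_odd os.
have vv := word_sqr (index_enum_uniq 'I_n).
have a0 : a != 0.
  apply/eqP=> a0; move: vv; rewrite -/volume va a0 scale0r mulr0 => /esym/eqP.
  by rewrite scaler_eq0 signr_eq0 oner_eq0.
rewrite -scalerAl -scalerAr mul1r mulr1 expr1 scaleN1r => /eqP.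
rewrite -subr_eq0 opprK -mulr2n -scaler_nat scalerA scaler_eq0 mulf_eq0.
by rewrite (negbTE a0) pnatr_eq0 => /eqP.
Qed.

Lemma scaled_volume_twisted : twisted (fun=> ~~ odd n) gs.
Proof. by apply: twistedZ; apply: volume_twisted. Qed.

(* Spans the elements with signs [P m (+) t]; it is [0] when the centrality of
   [gs] in odd dimension excludes such elements. *)
Definition block_word (P : pred 'I_n) (t : bool) : A :=
  (if t == odd #|P| then 1 else if odd n then 0 else gs) * subword P.

Lemma subword_sqr P : exists2 q : C, q != 0 & subword P * subword P = q *: 1.
Proof.
rewrite subwordE word_sqr ?filter_uniq ?index_enum_uniq //.
by eexists; last reflexivity; rewrite signr_eq0.
Qed.

Lemma block_word_twisted P t : twisted (fun m => P m (+) t) (block_word P t).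
Proof.
rewrite /block_word; have [->|ne] := eqVneq t (odd #|P|).
  by rewrite mul1r; apply: eq_twisted (subword_twisted P) => m; rewrite addbC.
have [on|en] := boolP (odd n); first by rewrite mul0r; apply: twisted0.
apply: eq_twisted (twistedM scaled_volume_twisted (subword_twisted P)) => m.
by rewrite en addbC [odd _ (+) _]addbC -addbA; case: t (odd _) ne => [] [].
Qed.

(** If [t] is the parity of [P], the word [subword P] has the required signs. Otherwise the
    eigenspace is zero for odd [n], and [gs] flips all signs for even [n]. *)
Lemma block_word_span P t s x : s =1 (fun m => P m (+) t) -> twisted s x ->
  exists a : C, x = a *: block_word P t.
Proof.
move=> sE hx.
have hx' : twisted (fun m => P m (+) t) x by apply: eq_twisted hx.
have := block_word_twisted P t; rewrite /block_word.
have [q q0 ww] := subword_sqr P.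
have [_|ne] := eqVneq t (odd #|P|).
  by rewrite mul1r => hw; apply: twisted_scale q0 ww hx' hw.
have [on _|en] := boolP (odd n).
  exists 0; rewrite scale0r; apply: (odd_twisted_eq0 on _ hx').
  by rewrite odd_sum_addb on andbT; case: (t) (odd _) ne => [] [].
move=> hw; have gw : gs * subword P = (-1) ^+ odd #|P| *: (subword P * gs).
  rewrite -scalerAl /volume (word_comm _ (subword_twisted P)) -/volume.
  rewrite -scalerAr scalerA mulrC -scalerA; congr (_ *: (_ *: _)).
  by rewrite -signr_odd (eq_bigr (fun m => P m (+) odd #|P| : nat)) => [|m _];
    rewrite ?odd_sum_addb ?(negbTE en) ?andbF ?addbF // addbC.
have vv := word_sqr (index_enum_uniq 'I_n); rewrite -/volume in vv.
(* The scalar [q] stays open until the square of [gs * subword P] has been computed. *)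
apply: twisted_scale hx' hw; last first.
  rewrite {2}gw -scalerAr mulrA -(mulrA gs) ww.
  rewrite !(=^~ scalerAl, =^~ scalerAr) mulr1 vv !scalerA; reflexivity.
by rewrite !mulf_neq0 ?signr_eq0.
Qed.

(** Projector onto the eigenspace of the involution [gconj m] for the eigenvalue [(-1) ^+ b]. *)
Definition half (m : 'I_n) (b : bool) (x : A) : A :=
  2^-1 *: (x + (-1) ^+ b *: gconj m x).

Lemma half_split m x : half m false x + half m true x = x.
Proof.
rewrite /half -scalerDr expr0 expr1 scale1r scaleN1r addrACA subrr addr0.
by rewrite -mulr2n -scaler_nat scalerA mulVf ?scale1r // pnatr_eq0.
Qed.

Lemma gconj_half_eq m b x : gconj m (half m b x) = (-1) ^+ b *: half m b x.
Proof.
rewrite /half gconjZ gconjD gconjZ gconjK scalerA mulrC -scalerA; congr (_ *: _).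
by rewrite scalerDr scalerA -signr_addb addbb expr0 scale1r addrC.
Qed.

Lemma gconj_half k m b x : gconj k (half m b x) = half m b (gconj k x).
Proof. by rewrite /half gconjZ gconjD gconjZ gconjC. Qed.

Lemma halfZ m b a x : half m b (a *: x) = a *: half m b x.
Proof.
by rewrite /half gconjZ scalerA (mulrC _ a) -scalerA -scalerDr !scalerA mulrC.
Qed.

Lemma halfD m b x y : half m b (x + y) = half m b x + half m b y.
Proof. by rewrite /half gconjD !scalerDr addrACA. Qed.

(* Decomposes a pair into simultaneous eigenvectors of all the [gconj m],
   halving along one generator at a time. *)
Lemma twisted_ind (Q F : A -> A -> Prop) :
    (forall m b c d, Q c d -> Q (half m b c) (half m b d)) ->
    (forall c d c' d', F c d -> F c' d' -> F (c + c') (d + d')) ->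
    (forall s c d, twisted s c -> twisted s d -> Q c d -> F c d) ->
  forall c d, Q c d -> F c d.
Proof.
move=> Qh FD Ft c d Qcd.
(* [l] lists the directions still to be split; outside [l] both elements are already eigenvectors,
   with common signs [s]. At the start [l] is everything, so [s] is arbitrary. *)
suff H (l : seq 'I_n) (s : 'I_n -> bool) x y : Q x y ->
    (forall m, m \notin l ->
       gconj m x = (-1) ^+ s m *: x /\ gconj m y = (-1) ^+ s m *: y) -> F x y.
  by apply: (H (enum 'I_n) (fun=> false)) => // m; rewrite mem_enum.
elim: l s x y => [|k l IH] s x y Qxy tw.
  by apply: (Ft s) => // m; case: (tw m isT).
rewrite -(half_split k x) -(half_split k y).
have tw' b m : m \notin l ->
    gconj m (half k b x) = (-1) ^+ (if m == k then b else s m) *: half k b x /\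
    gconj m (half k b y) = (-1) ^+ (if m == k then b else s m) *: half k b y.
  move=> ml; have [->|ne] := eqVneq m k; first by rewrite !gconj_half_eq.
  rewrite !gconj_half; case: (tw m) => [|-> ->]; last by rewrite !halfZ.
  by rewrite inE negb_or ne.
by apply: FD; apply: IH (Qh _ _ _ _ Qxy) (tw' _).
Qed.

(** * Blocks of generators and the shape of the coefficients *)

Section Blocks.
Variables (r : nat) (blk : 'I_n -> 'I_r).

Definition block_invariant x : Prop :=
  forall m k, blk m = blk k -> gconj m x = gconj k x.

(** Expresses that Omega vanishes on basis vectors of different blocks; see [Omega_eq0]. *)
Definition block_rel c d : Prop :=
  forall m k, blk m != blk k -> d + gconj m (gconj k d) = gconj m c + gconj k c.

Definition block_pair c d : Prop :=
  [/\ block_invariant c, block_invariant d & block_rel c d].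

Lemma block_relD c d c' d' :
  block_rel c d -> block_rel c' d' -> block_rel (c + c') (d + d').
Proof.
move=> h h' m k mk; rewrite !gconjD addrACA (h m k mk) (h' m k mk).
by rewrite addrACA.
Qed.

Lemma block_rel0 : block_rel 0 0.
Proof. by move=> m k _; rewrite !gconj0. Qed.

Lemma block_pair_half m b c d :
  block_pair c d -> block_pair (half m b c) (half m b d).
Proof.
case=> ic id rcd; split=> [k l kl|k l kl|k l kl]; rewrite !gconj_half.
- by rewrite (ic k l kl).
- by rewrite (id k l kl).
- by rewrite -!halfD (rcd k l kl).
Qed.

(** On signs [s] the relation compares [b] times 1 + s_m s_k with [a] times s_m + s_k; both factors
    vanish when the signs differ. *)
Lemma block_rel_twisted s x a b : twisted s x ->
    (forall m k, blk m != blk k -> s m = s k -> b = (-1) ^+ s m * a) ->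
  block_rel (a *: x) (b *: x).
Proof.
move=> hx h m k mk; rewrite !gconjZ !hx !gconjZ !hx !scalerA -!scalerDl.
congr (_ *: _); have [e|] := eqVneq (s m) (s k).
  rewrite (h m k mk e) -e [in X in X = _](mulrC _ a).
  by rewrite -!mulrA -signr_addb addbb expr0 mulr1 mulrC.
by case: (s m) (s k) => [] []; rewrite // expr0 expr1 ?mulr1 ?mulrN1 ?mul1r ?mulN1r
   ?subrr ?addNr.
Qed.

Hypothesis blk_surj : forall al, exists m, blk m = al.

(** Two signs within one block would give the same conjugate with opposite signs, forcing zero;
    hence [s] descends to the blocks, all of them nonempty. *)
Lemma block_pair_twisted s c d : block_pair c d -> twisted s c -> twisted s d ->
  (c = 0 /\ d = 0) \/
  exists2 sg : 'I_r -> bool, forall m, s m = sg (blk m) &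
    forall al be, al != be -> sg al = sg be -> d = (-1) ^+ sg al *: c.
Proof.
case=> ic id rcd hc hd.
case: (boolP [forall m, forall k, (blk m == blk k) ==> (s m == s k)]); last first.
  case/forallPn=> m /forallPn[k]; rewrite negb_imply => /andP[/eqP mk ne]; left.
  have := ic m k mk; have := id m k mk; rewrite !hc !hd.
  by move=> /(signZ_neq_eq0 ne) -> /(signZ_neq_eq0 ne) ->.
move=> /forallP sP; right.
have sE m k : blk m = blk k -> s m = s k.
  by move=> e; apply/eqP; have /forallP/(_ k)/implyP := sP m; apply; apply/eqP.
exists (fun al => [exists m, (blk m == al) && s m]) => [m|al be].
  apply/idP/existsP => [sm|[k /andP[/eqP e sk]]]; last by rewrite -(sE _ _ e).
  by exists m; rewrite eqxx.
have sgE m : [exists k, (blk k == blk m) && s k] = s m.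
  apply/existsP/idP => [[k /andP[/eqP e sk]]|sm]; first by rewrite -(sE _ _ e).
  by exists m; rewrite eqxx.
case: (blk_surj al) (blk_surj be) => [m <-] [k <-] mk; rewrite !sgE => e.
(* For equal signs the relation reads 2 [d] = 2 (s_m [c]). *)
have := rcd m k mk; rewrite !(hc, hd, gconjZ) e scalerA -signr_addb addbb expr0.
rewrite scale1r -!mulr2n -!scaler_nat => /(congr1 (fun y => 2^-1 *: y)).
by rewrite !scalerA !mulVf ?pnatr_eq0 // !scale1r mul1r.
Qed.

Definition cpl (a b : C) : A := a *: 1 + b *: gs.

(** In odd dimension [gs] is a scalar under [schur], so its coefficient is normalised to 0; this
    prepares the odd-dimensional refinement. *)
Definition hat (a : C) : C := if odd n then 0 else a.

Lemma cplD a b a' b' : cpl a b + cpl a' b' = cpl (a + a') (b + b').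
Proof. by rewrite /cpl !scalerDl addrACA. Qed.

Lemma cpl0 : cpl 0 0 = 0.
Proof. by rewrite /cpl !scale0r addr0. Qed.

Lemma hatD a b : hat (a + b) = hat a + hat b.
Proof. by rewrite /hat; case: ifP; rewrite ?addr0. Qed.

Lemma hat0 : hat 0 = 0.
Proof. by rewrite /hat; case: ifP. Qed.

Lemma cpl_mul_subword a b P :
  cpl a b * subword P = a *: subword P + b *: (gs * subword P).
Proof. by rewrite /cpl mulrDl -[a *: 1 * _]scalerAl mul1r -[b *: _ * _]scalerAl. Qed.

(** Converts the relation between [d] and [c] on one component into the sign pattern of form (c).
    When [t] is not the parity of [P], only even [n] contributes, and there [gs] accounts for the
    extra minus sign. *)
Lemma block_word_coef a P t : exists p q,
  a *: block_word P t = cpl p (hat q) * subword P /\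
  ((-1) ^+ t * a) *: block_word P t =
    (-1) ^+ #|P| *: (cpl p (- ((-1) ^+ n * hat q)) * subword P).
Proof.
rewrite /block_word; have [->|ne] := eqVneq t (odd #|P|).
  exists a, 0; rewrite hat0 mulr0 oppr0 /cpl scale0r addr0 mul1r -scalerAl mul1r.
  by rewrite scalerA signr_odd.
exists 0, a; rewrite /cpl !scale0r !add0r /hat; case: ifP => on.
  by rewrite !mul0r !scaler0 !mulr0 oppr0 !scale0r !mul0r scaler0.
rewrite -!scalerAl !scalerA; split=> //; congr (_ *: _).
rewrite [RHS]mulrA; congr (_ * _).
rewrite -[(-1) ^+ n]signr_odd on expr0 mul1r mulrN -mulNr; congr (_ * _).
by rewrite -[in RHS]signr_odd; case: t (odd _) ne => [] [] // _; rewrite ?expr0 ?expr1 ?opprK.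
Qed.

Definition in_block (al : 'I_r) : pred 'I_n := fun m => blk m == al.

(** The hypothesis confines [P] to one block, so equal signs in different blocks occur only outside
    [P]. There [subword P] has sign (-1)^|P| and [gs] has sign (-1)^(n+1). *)
Lemma block_rel_cpl (P : pred 'I_n) p q :
    (forall m k, blk m != blk k -> P m = P k -> P m = false) ->
  block_rel (cpl p q * subword P)
    ((-1) ^+ #|P| *: (cpl p (- ((-1) ^+ n * q)) * subword P)).
Proof.
move=> hP; rewrite !cpl_mul_subword scalerDr !scalerA.
apply: block_relD.
  apply: block_rel_twisted (subword_twisted P) _ => m k mk.
  by move=> /addbI e; rewrite (hP m k mk e) addbF signr_odd.
apply: block_rel_twisted (twistedM scaled_volume_twisted (subword_twisted P)) _.
move=> m k mk /addbI/addbI e; rewrite (hP m k mk e) addbF.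
by rewrite signr_addb signrN !signr_odd mulrN !mulNr mulrA [_ * (-1) ^+ n]mulrC.
Qed.

(** Opposite signs on different blocks make the relation empty, so the two coefficient pairs are
    independent; this is the free part of the case of two blocks. *)
Lemma block_rel_free (P : pred 'I_n) p q p' q' :
    (forall m k, blk m != blk k -> P m != P k) ->
  block_rel (cpl p q * subword P) (cpl p' q' * subword P).
Proof.
move=> hP; rewrite !cpl_mul_subword; apply: block_relD.
  apply: block_rel_twisted (subword_twisted P) _ => m k mk.
  by move=> /addbI /eqP; rewrite (negbTE (hP m k mk)).
apply: block_rel_twisted (twistedM scaled_volume_twisted (subword_twisted P)) _.
by move=> m k mk /addbI/addbI /eqP; rewrite (negbTE (hP m k mk)).
Qed.

Lemma subword0 : subword pred0 = 1.
Proof. exact: big_pred0. Qed.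

Definition coefs_a c d (c0 ch0 d0 dh0 : C) : Prop :=
  c = cpl c0 ch0 /\ d = cpl d0 dh0.

Definition coefs_b al c d (c0 ch0 c1 ch1 d1 dh1 : C) : Prop :=
  c = cpl c0 ch0 + cpl c1 ch1 * subword (in_block al) /\
  d = cpl c0 (- ((-1) ^+ n * ch0)) + cpl d1 dh1 * subword (in_block al).

Definition coefs_c c d (c0 ch0 : C) (cc ch : 'I_r -> C) : Prop :=
  c = cpl c0 ch0 + \sum_al cpl (cc al) (ch al) * subword (in_block al) /\
  d = cpl c0 (- ((-1) ^+ n * ch0))
    + \sum_al (-1) ^+ #|in_block al| *:
        (cpl (cc al) (- ((-1) ^+ n * ch al)) * subword (in_block al)).

Lemma block_rel_cpl0 p q : block_rel (cpl p q) (cpl p (- ((-1) ^+ n * q))).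
Proof.
have := @block_rel_cpl pred0 p q.
by rewrite card0 expr0 scale1r subword0 !mulr1; apply.
Qed.

Lemma coefs_b_rel al c d c0 ch0 c1 ch1 d1 dh1 : r = 2%N ->
  coefs_b al c d c0 ch0 c1 ch1 d1 dh1 -> block_rel c d.
Proof.
move=> r2 [-> ->]; apply: block_relD (block_rel_cpl0 _ _) _.
apply: block_rel_free => m k; rewrite /in_block; move: al (blk m) (blk k).
by rewrite r2 => -[[|[|//]] ?] [[|[|//]] ?] [[|[|//]] ?].
Qed.

Lemma coefs_c_rel c d c0 ch0 cc ch :
  coefs_c c d c0 ch0 cc ch -> block_rel c d.
Proof.
move=> [-> ->]; apply: block_relD (block_rel_cpl0 _ _) _.
elim/big_rec2: _ => [|al x y _ h]; first exact: block_rel0.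
apply: block_relD h; apply: block_rel_cpl => m k mk.
rewrite /in_block => e; apply/negP => /eqP ma; move: e; rewrite ma eqxx.
by move=> /esym/eqP ka; rewrite ma ka eqxx in mk.
Qed.

Lemma coefs_a_exist c d : (forall m k, blk m = blk k) ->
  block_pair c d -> exists c0 ch0 d0 dh0, coefs_a c d c0 (hat ch0) d0 (hat dh0).
Proof.
move=> bE; move: c d; apply: twisted_ind => [m b c d||].
- exact: block_pair_half.
- move=> c d c' d' [c0 [ch0 [d0 [dh0 [-> ->]]]]] [c1 [ch1 [d1 [dh1 [-> ->]]]]].
  exists (c0 + c1), (ch0 + ch1), (d0 + d1), (dh0 + dh1).
  by split; rewrite cplD hatD.
move=> s c d hc hd cd; have [[-> ->]|[sg sE _]] := block_pair_twisted cd hc hd.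
  by exists 0, 0, 0, 0; split; rewrite hat0 cpl0.
(* Without generators there is no common sign to read off, and [false] serves. *)
have [t st] : exists t, s =1 (fun m => pred0 m (+) t).
  case: (pickP 'I_n) => [m _|n0]; last by exists false => m; have := n0 m.
  by exists (s m) => k /=; rewrite !sE (bE k m).
have [a ->] := block_word_span st hc; have [b ->] := block_word_span st hd.
have [p [q [-> _]]] := block_word_coef a pred0 t.
have [p' [q' [-> _]]] := block_word_coef b pred0 t.
by exists p, q, p', q'; rewrite subword0 !mulr1.
Qed.

(** Components with equal signs on the two blocks give the linked coefficients, those with opposite
    signs the independent multiples of the word of block [al]. *)
Lemma coefs_b_exist al c d : r = 2%N -> block_pair c d ->
  exists c0 ch0 c1 ch1 d1 dh1,
    coefs_b al c d c0 (hat ch0) c1 (hat ch1) d1 (hat dh1).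
Proof.
move=> r2; move: c d; apply: twisted_ind => [m b c d||].
- exact: block_pair_half.
- move=> c d c' d' [a1 [a2 [a3 [a4 [a5 [a6 [-> ->]]]]]]].
  move=> [b1 [b2 [b3 [b4 [b5 [b6 [-> ->]]]]]]].
  exists (a1 + b1), (a2 + b2), (a3 + b3), (a4 + b4), (a5 + b5), (a6 + b6).
  split; rewrite addrACA !cplD -mulrDl cplD !hatD //.
  by rewrite mulrDr opprD.
move=> s c d hc hd cd; have [[-> ->]|[sg sE sgP]] := block_pair_twisted cd hc hd.
  exists 0, 0, 0, 0, 0, 0; split; rewrite !hat0 ?mulr0 ?oppr0 !cpl0 mul0r addr0 //.
have [be neq cover] : exists2 be, al != be & forall ga, ga = al \/ ga = be.
  clear -r2; move: al; rewrite r2 => -[[|[|//]] lt].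
    by exists (Ordinal (isT : (1 < 2)%N)) => // -[[|[|//]] lt'];
      [left|right]; apply: val_inj.
  by exists (Ordinal (isT : (0 < 2)%N)) => // -[[|[|//]] lt'];
      [right|left]; apply: val_inj.
have [e|ne] := eqVneq (sg al) (sg be).
  have st : s =1 (fun m => pred0 m (+) sg al).
    by move=> m; rewrite sE /=; case: (cover (blk m)) => ->.
  rewrite (sgP _ _ neq e); have [a ->] := block_word_span st hc.
  have [p [q [h1 h2]]] := block_word_coef a pred0 (sg al).
  exists p, q, 0, 0, 0, 0; rewrite /coefs_b scalerA h1 h2 hat0 cpl0 mul0r !addr0.
  by rewrite card0 expr0 scale1r subword0 !mulr1.
have st : s =1 (fun m => in_block al m (+) sg be).
  move=> m; rewrite sE /in_block; case: (cover (blk m)) => ->.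
    by rewrite eqxx; case: (sg al) (sg be) ne => [] [].
  by rewrite eq_sym (negbTE neq).
have [a ->] := block_word_span st hc; have [b ->] := block_word_span st hd.
have [p [q [-> _]]] := block_word_coef a (in_block al) (sg be).
have [p' [q' [-> _]]] := block_word_coef b (in_block al) (sg be).
exists 0, 0, p, q, p', q'.
by split; rewrite hat0 ?mulr0 ?oppr0 cpl0 add0r.
Qed.

Lemma coefs_c_exist c d : (2 < r)%N -> block_pair c d ->
  exists c0 ch0 (cc ch : 'I_r -> C), coefs_c c d c0 (hat ch0) cc (hat \o ch).
Proof.
move=> r2; move: c d; apply: twisted_ind => [m b c d||].
- exact: block_pair_half.
- move=> c d c' d' [a1 [a2 [a3 [a4 [-> ->]]]]] [b1 [b2 [b3 [b4 [-> ->]]]]].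
  exists (a1 + b1), (a2 + b2), (fun al => a3 al + b3 al), (fun al => a4 al + b4 al).
  split; rewrite addrACA !cplD !hatD -?opprD -?mulrDr -big_split;
    congr (_ + _); apply: eq_bigr => al _ /=; rewrite hatD.
    by rewrite -mulrDl cplD.
  by rewrite -scalerDr -mulrDl cplD -opprD -mulrDr.
move=> s c d hc hd cd; have F0 : exists c0 ch0 (cc ch : 'I_r -> C),
    coefs_c 0 0 c0 (hat ch0) cc (hat \o ch).
  exists 0, 0, (fun=> 0), (fun=> 0).
  by split; rewrite hat0 ?mulr0 ?oppr0 cpl0 add0r big1 // => al _ /=;
    rewrite hat0 ?mulr0 ?oppr0 cpl0 mul0r ?scaler0.
have [[-> ->]//|[sg sE sgP]] := block_pair_twisted cd hc hd.
(* Since [2 < r], at least two blocks remain besides [al], and their common sign ties [d] to [c]. *)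
have outP al t : (forall be, be != al -> sg be = t) -> d = (-1) ^+ t *: c.
  move=> h; have : (1 < #|~: [set al]|)%N by rewrite cardsC1 card_ord -subn1 ltn_subRL.
  case/card_gt1P=> be [ga [hb hg ne]]; rewrite !inE in hb hg.
  by rewrite -(h _ hb); apply: sgP ne _; rewrite !h.
have flip al t : (forall be, sg be = (be == al) (+) t) ->
    exists c0 ch0 (cc ch : 'I_r -> C), coefs_c c d c0 (hat ch0) cc (hat \o ch).
  move=> h; rewrite (outP al t) => [|be]; last by rewrite h => /negbTE ->.
  have st : s =1 (fun m => in_block al m (+) t) by move=> m; rewrite sE h.
  have [a ->] := block_word_span st hc; rewrite scalerA.
  have [p [q [-> ->]]] := block_word_coef a (in_block al) t.
  exists 0, 0, (fun be => if be == al then p else 0), (fun be => if be == al then q else 0).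
  split; rewrite hat0 ?mulr0 ?oppr0 cpl0 add0r (bigD1 al) //= eqxx big1 ?addr0 //.
    by move=> be /negbTE ->; rewrite hat0 cpl0 mul0r.
  by move=> be /negbTE ->; rewrite hat0 mulr0 oppr0 cpl0 mul0r scaler0.
have const t : (forall be, sg be = t) ->
    exists c0 ch0 (cc ch : 'I_r -> C), coefs_c c d c0 (hat ch0) cc (hat \o ch).
  move=> h; rewrite (outP (Ordinal (ltnW (ltnW r2))) t) //.
  have st : s =1 (fun m => pred0 m (+) t) by move=> m; rewrite sE h.
  have [a ->] := block_word_span st hc; rewrite scalerA.
  have [p [q [-> ->]]] := block_word_coef a pred0 t.
  exists p, q, (fun=> 0), (fun=> 0); rewrite card0 expr0 scale1r subword0 !mulr1.
  by split; rewrite big1 ?addr0 // => al _ /=;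
    rewrite hat0 ?mulr0 ?oppr0 cpl0 mul0r ?scaler0.
have [[t]|[[al [t]]|[a1 [a2 [b1 [b2 [na nb [sa1 sa2] [sb1 sb2]]]]]]]] := bool_fun_cases sg.
- exact: const.
- exact: flip.
have dp : d = - c by rewrite (sgP _ _ na) ?sa1 ?sa2 // expr1 scaleN1r.
have dm : d = c by rewrite (sgP _ _ nb) ?sb1 ?sb2 // expr0 scale1r.
have c0 : c = 0.
  by apply: (@signZ_neq_eq0 true false) => //; rewrite expr1 expr0 scaleN1r scale1r -dp.
by rewrite dm c0.
Qed.

End Blocks.
End Schur.
End CliffordGenerators.

(** * Irreducible Clifford modules *)

(** All generators are moved to the right of [c] and [d], which conjugates these; reversing
    [G k * G m] then yields a common right factor. *)
Lemma omega_expand (C : numFieldType) (A : algType C) n (G : 'I_n -> A)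
    (G_sqr : forall m, G m * G m = -1)
    (G_anti : forall m k, m != k -> G m * G k = - (G k * G m)) c d m k :
  m != k ->
  (d * G m - G m * c) * G k + G k * (c * G m - G m * d) =
  (d + gconj G m (gconj G k d) - (gconj G m c + gconj G k c)) * (G m * G k).
Proof.
move=> mk; have E j x := gconj_mulG G_sqr j x.
rewrite mulrBl mulrBr !mulrA (E m c) (E k c) -[G k * G m * d]mulrA (E m d).
rewrite [G k * (_ * _)]mulrA (E k (gconj G m d)) (gconjC G_anti).
rewrite -![_ * G k * G m]mulrA -!(mulrA _ (G m)) (G_anti k m) 1?eq_sym //.
rewrite !mulrN opprK mulrBl !mulrDl opprD -!addrA; congr (_ + _).
by rewrite addrA addrC.
Qed.

Section IrreducibleModule.
Variables (R : realType) (V : vectType R) (N : nat) (gam : V -> 'M[R[i]]_N.+1).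

(** Over the algebraically closed [R[i]], [x] has an eigenvalue [a]; the kernel of [x - a%:M] is a
    nonzero submodule, hence everything. *)
Lemma irreducible_schur (x : 'M[R[i]]_N.+1) : irreducible_module gam ->
  (forall v, gam v * x = x * gam v) -> exists a, x = a%:M.
Proof.
move=> [_ irr] cx.
(* Eigenvectors are rows whereas the module consists of columns, hence the transpose. *)
have [a] : exists a, root (char_poly x^T) a.
  by apply/closed_rootP; rewrite size_char_poly.
rewrite -eigenvalue_root_char => /eigenvalueP[u ux u0].
pose U := lker (linfun (mulmx (x - a%:M)) : 'Hom('cV[R[i]]_N.+1, 'cV[R[i]]_N.+1)).
have UE s : (s \in U) = ((x - a%:M) *m s == 0) by rewrite memv_ker lfunE.
have stable v s : s \in U -> gam v *m s \in U.
  rewrite !UE => /eqP h; rewrite mulmxA.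
  have -> : (x - a%:M) *m gam v = gam v *m (x - a%:M).
    by rewrite mulmxBl mulmxBr scalar_mxC; congr (_ - _); rewrite -[LHS]cx.
  by rewrite -mulmxA h mulmx0.
exists a; case: (irr U stable) => Ueq.
  have : u^T \in U.
    rewrite UE mulmxBl -{1}[x]trmxK -trmx_mul ux mul_scalar_mx linearZ /=.
    by rewrite subrr.
  by rewrite Ueq memv0 -[0]trmx0 (inj_eq trmx_inj) (negbTE u0).
apply/eqP; rewrite -subr_eq0; apply/eqP/matrixP=> i j.
have : delta_mx j 0 \in U by rewrite Ueq memvf.
rewrite UE -colE => /eqP/matrixP/(_ i 0).
by rewrite [LHS]mxE [in RHS]mxE => ->; rewrite mxE.
Qed.

End IrreducibleModule.

(** * Plane rotations and tensors in so_B(V) (x) Cl(V) *)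

Section OrthonormalBasis.
Variables (R : realType) (V : vectType R) (g : {dot V for idfun}).
Variables (n : nat) (e : n.-tuple V).
Hypothesis e_orth : orthonormal_basis g fullv e.

Lemma dotC u v : g u v = g v u.
Proof. by rewrite hermC /= expr0 mul1r. Qed.

(** The infinitesimal rotation in the plane of two basis vectors. *)
Lemma rotation_exists m k : exists A : 'End(V),
  forall v, A v = g v (tnth e m) *: tnth e k - g v (tnth e k) *: tnth e m.
Proof.
pose f v := g v (tnth e m) *: tnth e k - g v (tnth e k) *: tnth e m.
have lf : linear f.
  move=> a u v; rewrite /f !linearDl /= !linearZl_LR /= !scalerDl scalerBr.
  by rewrite !scalerA opprD addrACA.
pose F : {linear V -> V} := HB.pack f (GRing.isLinear.Build _ _ _ _ f lf).
by exists (linfun F) => v; rewrite lfunE.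
Qed.

Lemma dot_rotation (A : 'End(V)) m k v w :
    (forall v, A v = g v (tnth e m) *: tnth e k - g v (tnth e k) *: tnth e m) ->
  g (A v) w = g v (tnth e m) * g w (tnth e k) - g v (tnth e k) * g w (tnth e m).
Proof.
move=> ->; rewrite linearDl /= linearNl /= !linearZl_LR /=.
by rewrite [g (tnth e k) w]dotC [g (tnth e m) w]dotC.
Qed.

Variables (B : 'End(V)) (ev : 'I_n -> R).
Hypothesis B_sym : g_symmetric g B.
Hypothesis B_diag : forall m, B (tnth e m) = ev m *: tnth e m.

(** [B] is symmetric and acts on the plane by one scalar, so composing with [B] on either side
    multiplies the rotation by it. *)
Lemma rotation_soB (A : 'End(V)) m k : ev m = ev k ->
    (forall v, A v = g v (tnth e m) *: tnth e k - g v (tnth e k) *: tnth e m) ->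
  soB g B A.
Proof.
move=> mk AE; split=> [v w|].
  by rewrite [g v _]dotC !(dot_rotation _ _ AE) opprB ![g w _ * _]mulrC.
apply/lfunP=> v; rewrite !comp_lfunE !AE linearB !linearZ /= !B_sym !B_diag.
by rewrite !linearZr_LR /= !scalerN !scalerA mk ![ev k * _]mulrC.
Qed.

Variables (N : nat) (W : V -> V -> 'M[R[i]]_N.+1).
Hypothesis WDl : forall u v w, W (u + v) w = W u w + W v w.
Hypothesis WDr : forall u v w, W w (u + v) = W w u + W w v.
Hypothesis WZl : forall a v w, W (a *: v) w = a%:C *: W v w.
Hypothesis WZr : forall a v w, W w (a *: v) = a%:C *: W w v.

Lemma bilinear_coord v w : W v w =
  \sum_m \sum_k (g v (tnth e m) * g w (tnth e k))%:C *: W (tnth e m) (tnth e k).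
Proof.
have W0l u : W 0 u = 0 by rewrite -(scale0r 0) WZl scale0r.
have W0r u : W u 0 = 0 by rewrite -(scale0r 0) WZr scale0r.
rewrite {1}(orthonormal_coord e_orth v).
rewrite (big_morph (W^~ w) (fun u u' => WDl u u' w) (W0l w)).
apply: eq_bigr => m _; rewrite WZl {1}(orthonormal_coord e_orth w).
rewrite (big_morph (W _) (fun u u' => WDr u u' _) (W0r _)) scaler_sumr.
by apply: eq_bigr => k _; rewrite WZr scalerA rmorphM.
Qed.

Hypothesis W_skew : forall m k, W (tnth e k) (tnth e m) = - W (tnth e m) (tnth e k).

(** An endomorphism commuting with [B] has no matrix entry between different eigenvalues.
    Conversely, a skew [W] without such entries expands in the rotations inside the eigenspaces. *)
Lemma in_soB_tensor_ClP : in_soB_tensor_Cl g B W <->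
  forall m k, ev m != ev k -> W (tnth e m) (tnth e k) = 0.
Proof.
split=> [[p [A [x [soA WE]]]] m k mk|W0].
  rewrite WE big1 // => j _; have [_ AB] := soA j.
  have : g (A j (B (tnth e m))) (tnth e k) = g (A j (tnth e m)) (B (tnth e k)).
    by rewrite -B_sym -!comp_lfunE AB.
  rewrite !B_diag linearZ /= linearZl_LR linearZr_LR /= => /eqP.
  rewrite -subr_eq0 -mulrBl mulf_eq0 subr_eq0 (negbTE mk) => /eqP ->.
  by rewrite rmorph0 scale0r.
have /fin_all_exists[A AP] (t : 'I_n * 'I_n) : exists A : 'End(V), soB g B A /\
    (ev t.1 = ev t.2 -> forall v w, g (A v) w =
       g v (tnth e t.1) * g w (tnth e t.2) - g v (tnth e t.2) * g w (tnth e t.1)).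
  have [A AE] := rotation_exists t.1 t.2.
  have [eq|ne] := eqVneq (ev t.1) (ev t.2).
    exists A; split; first exact: rotation_soB eq AE.
    by move=> _ v w; apply: dot_rotation.
  exists 0; split=> [|/eqP]; last by rewrite (negbTE ne).
  split=> [v w|]; first by rewrite !zero_lfunE linear0l linear0r oppr0.
  by rewrite comp_lfun0l comp_lfun0r.
exists #|{: 'I_n * 'I_n}|, (fun j => A (enum_val j)).
(* Ordered pairs count every plane twice, hence the factor [2^-1]. *)
exists (fun j => 2^-1 *: W (tnth e (enum_val j).1) (tnth e (enum_val j).2)).
split=> [j|v w]; first by case: (AP (enum_val j)).
pose F (t : 'I_n * 'I_n) := (g (A t v) w)%:C *: (2^-1 *: W (tnth e t.1) (tnth e t.2)).
have -> : \sum_(j < #|{: 'I_n * 'I_n}|) F (enum_val j) = \sum_t F t.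
  by rewrite [RHS](reindex _ (onW_bij _ (enum_val_bij _))).
pose a m k := (g v (tnth e m) * g w (tnth e k))%:C.
have FE m k : F (m, k) = 2^-1 *: (a m k *: W (tnth e m) (tnth e k))
                       + 2^-1 *: (a k m *: W (tnth e k) (tnth e m)).
  rewrite /F /= (W_skew m k); have [eq|ne] := eqVneq (ev m) (ev k); last first.
    by rewrite (W0 m k ne) oppr0 !scaler0 addr0.
  rewrite (proj2 (AP (m, k)) eq) /= rmorphB /= -/(a m k) -/(a k m).
  by rewrite scalerN scalerN -scalerBr -scalerBl !scalerA mulrC.
rewrite (eq_bigr (fun t => F (t.1, t.2))) => [|[]//].
rewrite -(pair_bigA _ (fun m k => F (m, k))) /=.
under eq_bigr => m _ do under eq_bigr => k _ do rewrite FE.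
under eq_bigr => m _ do rewrite big_split /=.
rewrite big_split /= [X in _ + X]exchange_big /= -mulr2n.
rewrite [LHS]bilinear_coord -scaler_nat scaler_sumr; apply: eq_bigr => m _.
rewrite scaler_sumr; apply: eq_bigr => k _.
by rewrite scalerA mulfV ?scale1r // pnatr_eq0.
Qed.

End OrthonormalBasis.


(** * Generators, Omega and the spin representation in an orthonormal basis *)

Section CliffordMap.
Variables (R : realType) (V : vectType R) (g : {dot V for idfun}) (N : nat).
Variable gam : V -> 'M[R[i]]_N.+1.
Hypothesis gam_clifford : clifford_map g gam.
Variables (n : nat) (e : n.-tuple V).
Hypothesis e_orth : orthonormal_basis g fullv e.
Local Notation G := (Gam gam e : 'I_n -> 'M[R[i]]_N.+1).

Lemma Gam_sqr m : G m * G m = -1.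
Proof.
have := clifford_mapM gam_clifford (tnth e m) (tnth e m).
rewrite (orthonormal_basisE e_orth) eqxx mulr1 -scalemx1 rmorphN rmorph_nat -mulr2n.
rewrite scaleNr -[_ *+ 2]scaler_nat => /(congr1 (fun y => 2^-1 *: y)).
by rewrite scalerN !scalerA mulVf ?pnatr_eq0 // !scale1r.
Qed.

Lemma Gam_anti m k : m != k -> G m * G k = - (G k * G m).
Proof.
move=> mk; have := clifford_mapM gam_clifford (tnth e m) (tnth e k).
rewrite (orthonormal_basisE e_orth) (negbTE mk) mulr0 oppr0 -scalemx1.
by rewrite rmorph0 scale0r => /eqP; rewrite addr_eq0 => /eqP.
Qed.

Lemma gam_coord v : gam v = \sum_m (g v (tnth e m))%:C *: G m.
Proof.
rewrite {1}(orthonormal_coord e_orth v).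
rewrite (big_morph gam (clifford_mapD gam_clifford) (_ : gam 0 = 0)); last first.
  by rewrite -(scale0r 0) (clifford_mapZ gam_clifford) scale0r.
by apply: eq_bigr => m _; rewrite (clifford_mapZ gam_clifford).
Qed.

(** Provides [schur]: being fixed by all conjugations means commuting with the generators, hence
    with every [gam v]. *)
Lemma twisted_scalar (irr : irreducible_module gam) x :
  twisted G (fun=> false) x -> exists a : R[i], x = a *: 1.
Proof.
move=> tw; have [|a ->] := irreducible_schur (x := x) irr; last first.
  by exists a; rewrite -scalemx1.
move=> v; rewrite gam_coord mulr_suml mulr_sumr; apply: eq_bigr => m _.
by rewrite -scalerAl -scalerAr (gconj_mulG Gam_sqr) tw expr0 scale1r.
Qed.

Section Omega.
Variables c d : 'M[R[i]]_N.+1.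
Local Notation W := (Omega gam c d).

Lemma s_mapD a b v w : s_map gam a b (v + w) = s_map gam a b v + s_map gam a b w.
Proof. by rewrite /s_map (clifford_mapD gam_clifford) mulrDr mulrDl opprD addrACA. Qed.

Lemma s_mapZ a b (t : R) v : s_map gam a b (t *: v) = t%:C *: s_map gam a b v.
Proof.
by rewrite /s_map (clifford_mapZ gam_clifford) -scalerAl -scalerAr scalerBr.
Qed.

Lemma OmegaDl u v w : W (u + v) w = W u w + W v w.
Proof. by rewrite /Omega !s_mapD mulrDr mulrDl addrACA. Qed.

Lemma OmegaDr u v w : W w (u + v) = W w u + W w v.
Proof. by rewrite /Omega (clifford_mapD gam_clifford) mulrDr (mulrDl (gam u)) addrACA. Qed.

Lemma OmegaZl t v w : W (t *: v) w = t%:C *: W v w.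
Proof. by rewrite /Omega !s_mapZ -scalerAl -scalerAr scalerDr. Qed.

Lemma OmegaZr t v w : W w (t *: v) = t%:C *: W w v.
Proof.
by rewrite /Omega (clifford_mapZ gam_clifford) -scalerAl -scalerAr scalerDr.
Qed.

Lemma Omega_basisE m k : m != k -> W (tnth e m) (tnth e k) =
  (d + gconj G m (gconj G k d) - (gconj G m c + gconj G k c)) * (G m * G k).
Proof. exact: (omega_expand Gam_sqr Gam_anti). Qed.

(** Off the diagonal, the conjugation factor is symmetric in [m] and [k] while [G m * G k] is
    antisymmetric. *)
Lemma Omega_skew m k : W (tnth e k) (tnth e m) = - W (tnth e m) (tnth e k).
Proof.
have [->|mk] := eqVneq m k.
  suff -> : W (tnth e k) (tnth e k) = 0 by rewrite oppr0.
  rewrite /Omega /s_map -/(G k) mulrBl mulrBr !mulrA -(mulrA d).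
  by rewrite Gam_sqr mulrN1 mulN1r opprK addrA subrK addNr.
rewrite Omega_basisE 1?eq_sym // Omega_basisE //.
rewrite (gconjC Gam_anti) [gconj G k c + _]addrC.
by rewrite (Gam_anti mk) mulrN opprK.
Qed.

(** The right factor [G m * G k] is invertible with inverse [G k * G m]. *)
Lemma Omega_eq0 m k : m != k -> W (tnth e m) (tnth e k) = 0 <->
  d + gconj G m (gconj G k d) = gconj G m c + gconj G k c.
Proof.
move=> mk; rewrite (Omega_basisE mk).
split=> [|h]; last first.
  by rewrite h subrr; exact: mul0r.
move=> /(congr1 (fun y => y * (G k * G m))).
rewrite mul0r -mulrA [G m * G k * _]mulrA -(mulrA (G m)) Gam_sqr mulrN1 mulNr.
by rewrite Gam_sqr opprK mulr1 => /eqP; rewrite subr_eq0 => /eqP.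
Qed.

End Omega.

(** Only the terms [G m * G k] and [- (G k * G m)] survive; they coincide and turn the factor 1/4
    into 1/2. *)
Lemma spin_rep_rotation (A : 'End(V)) m k : m != k ->
    (forall v, A v = g v (tnth e m) *: tnth e k - g v (tnth e k) *: tnth e m) ->
  spin_rep g gam e A = 2^-1 *: (G m * G k).
Proof.
move=> mk AE; rewrite /spin_rep.
have single m' k' : m' != k' ->
    \sum_a \sum_(b | a != b) ((a == m')%:R * (b == k')%:R)%:C *: (G a * G b)
    = G m' * G k'.
  move=> mk'; rewrite (bigD1 m') //= [X in _ + X]big1 => [|a /negbTE na].
    rewrite (bigD1 k') //= big1 => [|b /andP[_ /negbTE nb]].
      by rewrite !eqxx mulr1 scale1r !addr0.
    by rewrite nb mulr0 scale0r.
  by rewrite big1 // => b _; rewrite na mul0r scale0r.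
have -> : \sum_a \sum_(b | a != b) (g (A (tnth e a)) (tnth e b))%:C *: (G a * G b)
    = G m * G k - G k * G m.
  rewrite -(single m k mk) -(single k m) 1?eq_sym // -sumrB.
  apply: eq_bigr => a _; rewrite -sumrB; apply: eq_bigr => b ab.
  rewrite (dot_rotation _ _ AE) !(orthonormal_basisE e_orth) -scalerBl.
  by rewrite rmorphB.
rewrite (Gam_anti (m := k)) 1?eq_sym // opprK -mulr2n -[_ * _ *+ 2]scaler_nat scalerA.
by congr (_ *: _); rewrite -[4]/(2 * 2)%:R natrM invfM -mulrA mulVf ?mulr1 // pnatr_eq0.
Qed.

(** Invariance under a rotation says that [G m * G k] commutes with [x]; multiplying by [G m] on the
    left and [G k] on the right equates the two conjugates. *)
Lemma soB_invariant_gconj (B : 'End(V)) (ev : 'I_n -> R) x :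
    g_symmetric g B -> (forall m, B (tnth e m) = ev m *: tnth e m) ->
    soB_invariant g B gam e x ->
  forall m k, ev m = ev k -> gconj G m x = gconj G k x.
Proof.
move=> Bs Bd ix m k evE; have [->//|mk] := eqVneq m k.
have [A AE] := rotation_exists g e m k.
have := ix A (rotation_soB Bs Bd evE AE); rewrite (spin_rep_rotation mk AE).
rewrite -scalerAl -scalerAr => /(congr1 (fun y => 2 *: y)).
have n2 : (2 : R[i]) != 0 by rewrite pnatr_eq0.
rewrite !scalerA (mulfV n2) !scale1r => h.
have := congr1 (fun y => G m * y * G k) h; rewrite /gconj !mulrA Gam_sqr.
rewrite -(mulrA _ (G k) (G k)) Gam_sqr mulrN1 mulN1r !mulNr => hk.
rewrite hk; reflexivity.
Qed.

(** For n = 2k+1 the power of ['i] squares to (-1)^(k+1) and the volume to (-1)^((k+1)(2k+1)); the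
    exponents have equal parity. *)
Lemma Gam_star_sqr : odd n -> Gam_star gam e * Gam_star gam e = 1.
Proof.
move=> on; rewrite /Gam_star.
have := word_sqr Gam_sqr Gam_anti (index_enum_uniq 'I_n).
rewrite /word => vv; rewrite -scalerAl -scalerAr vv !scalerA.
rewrite -expr2 exprAC sqrCi size_ord_enum -exprD -signr_odd.
suff -> : odd ((n.+1)./2 + 'C(n.+1, 2)) = false by rewrite expr0 scale1r.
rewrite -(odd_double_half n) on add1n; move: n./2 => k.
rewrite -doubleS doubleK bin2 -doubleMl doubleK /= oddD oddM /= odd_double.
by case: (odd k).
Qed.

Lemma Gam_star_odd : irreducible_module gam -> odd n ->
  Gam_star gam e = 1 \/ Gam_star gam e = -1.
Proof.
move=> irr on; have := Gam_star_sqr on.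
have tw : twisted G (fun=> false) (Gam_star gam e).
  apply: eq_twisted (scaled_volume_twisted Gam_sqr Gam_anti _) => m.
  by rewrite on.
have [a ->] := twisted_scalar irr tw.
rewrite -scalerAl -scalerAr mulr1 scalerA -expr2 -[in RHS](scale1r 1) => /eqP.
rewrite -subr_eq0 -scalerBl scaler_eq0 oner_eq0 orbF subr_eq0 sqrf_eq1.
by case/orP=> /eqP ->; [left; rewrite scale1r | right; rewrite scaleN1r].
Qed.

End CliffordMap.


(** * Eigenspaces as blocks of the adapted basis *)

Section EigenBlocks.
Variables (R : realType) (V : vectType R) (g : {dot V for idfun}) (B : 'End(V)).
Variables (r : nat) (lam : r.-tuple R) (lam_spec : spectrum B lam).
Variables (n : nat) (e : n.-tuple V) (e_adapted : adapted_basis g B e).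

Lemma mem_leigenspace a v : (v \in leigenspace B a) = (B v == a *: v).
Proof.
by rewrite memv_ker !lfunE /= opp_lfunE scale_lfunE id_lfunE subr_eq0.
Qed.

Lemma tnth_neq0 m : tnth e m != 0.
Proof.
case: e_adapted => eo _ _; apply/eqP=> e0; have := orthonormal_basisE eo m m.
by rewrite e0 linear0l eqxx => /esym/eqP; rewrite oner_eq0.
Qed.

(** No block is empty: an eigenspace is nonzero and spanned by the basis vectors lying in it. *)
Lemma eigen_blocks : exists blk : 'I_n -> 'I_r,
  (forall m al, (tnth e m \in leigenspace B (tnth lam al)) = (blk m == al)) /\
  (forall al, exists m, blk m = al).
Proof.
case: e_adapted lam_spec => eo eB eE [lam_uniq lamP].
have /fin_all_exists[blk blkP] m :
    exists al, tnth e m \in leigenspace B (tnth lam al).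
  have [a ea] := eB m.
  have /tnthP[al aE] : a \in lam.
    rewrite -lamP /leigenvalue; apply: contraTneq ea => ->.
    by rewrite memv0 tnth_neq0.
  by exists al; rewrite -aE.
have blkE m al : (tnth e m \in leigenspace B (tnth lam al)) = (blk m == al).
  apply/idP/eqP=> [|<-//]; have := blkP m.
  rewrite !mem_leigenspace => /eqP -> /eqP/eqP.
  rewrite -subr_eq0 -scalerBl scaler_eq0 (negbTE (tnth_neq0 m)) orbF subr_eq0.
  by rewrite (inj_eq (tuple_uniqP _ lam_uniq)) => /eqP.
exists blk; split=> // al.
have : leigenvalue B (tnth lam al) by rewrite lamP mem_tnth.
case: (eE (tnth lam al)) => [/andP[/eqP spanE _] _] /negP nz.
have [m mal|no] := pickP (fun m => blk m == al); first by exists m; apply/eqP.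
case: nz; apply/eqP.
rewrite -spanE (eq_in_filter (a2 := pred0)) ?filter_pred0 ?span_nil //.
by move=> x /tnthP[m ->]; rewrite blkE no.
Qed.

Lemma dim_leigenspace_card al (P : pred 'I_n) :
    (forall m, (tnth e m \in leigenspace B (tnth lam al)) = P m) ->
  \dim (leigenspace B (tnth lam al)) = #|P|.
Proof.
move=> PE; case: e_adapted => _ _ /(_ (tnth lam al))[eb _].
rewrite (size_basis (X := in_tuple _) eb) /= size_filter.
rewrite -[in LHS](map_tnth_enum e) count_map -sum1_card -sum1_count big_enum_cond.
by apply: eq_bigl => m; rewrite /= PE.
Qed.

End EigenBlocks.

(** Replaces [hat \o ch] by the zero function pointwise in odd dimension. *)
Lemma form_c_eq_coef (R : realType) (V : vectType R) (B : 'End(V)) N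
    (gam : V -> 'M[R[i]]_N) n (e : n.-tuple V) r (lam : r.-tuple R) c d c0 ch0 cc
    (ch ch' : 'I_r -> R[i]) : ch =1 ch' ->
  form_c B gam e lam c d c0 ch0 cc ch -> form_c B gam e lam c d c0 ch0 cc ch'.
Proof.
by move=> E [-> ->]; split; congr (_ + _); apply: eq_bigr => al _; rewrite E.
Qed.

Theorem proposition4p1 (R : realType) (V : vectType R) (g : {dot V for idfun})
  (N : nat) (gam : V -> 'M[R[i]]_N)
  (gam_clifford : clifford_map g gam) (gam_irr : irreducible_module gam)
  (B : 'End(V)) (B_sym : g_symmetric g B)
  (r : nat) (lam : r.-tuple R) (lam_spec : spectrum B lam)
  (e : (\dim {:V}).-tuple V) (e_adapted : adapted_basis g B e)
  (c d : 'M[R[i]]_N)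
  (c_inv : soB_invariant g B gam e c) (d_inv : soB_invariant g B gam e d) :
  [/\ (exists a : R, B = a *: \1%VF) ->
        (in_soB_tensor_Cl g B (Omega gam c d) <->
         exists c0 ch0 d0 dh0, form_a gam e c d c0 ch0 d0 dh0),
      r = 2%N ->
        (in_soB_tensor_Cl g B (Omega gam c d) <->
         exists c0 ch0 c1 ch1 d1 dh1,
           form_b B gam e lam`_0 c d c0 ch0 c1 ch1 d1 dh1),
      (2 < r)%N ->
        (in_soB_tensor_Cl g B (Omega gam c d) <->
         exists c0 ch0 (cc ch : 'I_r -> R[i]),
           form_c B gam e lam c d c0 ch0 cc ch) &
      odd (\dim {:V}) ->
        [/\ Gam_star gam e = 1 \/ Gam_star gam e = -1,
            (exists a : R, B = a *: \1%VF) ->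
              (in_soB_tensor_Cl g B (Omega gam c d) <->
               exists c0 d0, form_a gam e c d c0 0 d0 0),
            r = 2%N ->
              (in_soB_tensor_Cl g B (Omega gam c d) <->
               exists c0 c1 d1,
                 form_b B gam e lam`_0 c d c0 0 c1 0 d1 0) &
            (2 < r)%N ->
              (in_soB_tensor_Cl g B (Omega gam c d) <->
               exists c0 (cc : 'I_r -> R[i]),
                 form_c B gam e lam c d c0 0 cc (fun=> 0))]].
Proof.
(* Irreducibility excludes size zero, and size [N.+1] gives the algebra structure used above. *)
case: N gam gam_clifford gam_irr c d c_inv d_inv => [|N] gam gcl irr c d ci di.
  by case: irr.
have [eo eB eE] := e_adapted.
have [blk [blkE blk_surj]] := eigen_blocks lam_spec e_adapted.
pose G : 'I_(\dim {:V}) -> 'M[R[i]]_N.+1 := Gam gam e.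
have G_sqr : forall m, G m * G m = -1 := Gam_sqr gcl eo.
have G_anti : forall m k, m != k -> G m * G k = - (G k * G m) := Gam_anti gcl eo.
have schur := twisted_scalar gcl eo irr.
pose z : R[i] := 'i%R ^+ (\dim {:V}).+1./2.
have z_neq0 : z != 0 by rewrite expf_neq0 ?neq0Ci.
pose ev m := tnth lam (blk m).
have evE m k : (ev m == ev k) = (blk m == blk k).
  by rewrite (inj_eq (tuple_uniqP _ (proj1 lam_spec))).
have B_diag m : B (tnth e m) = ev m *: tnth e m.
  by apply/eqP; rewrite -mem_leigenspace blkE.
have inv x : soB_invariant g B gam e x -> block_invariant G blk x.
  move=> ix m k mk; apply: (soB_invariant_gconj gcl eo B_sym B_diag ix).
  by rewrite /ev mk.
have tensorP : in_soB_tensor_Cl g B (Omega gam c d) <-> block_rel G blk c d.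
  have [T1 T2] := in_soB_tensor_ClP eo B_sym B_diag (OmegaDl gcl c d)
    (OmegaDr gcl c d) (OmegaZl gcl c d) (OmegaZr gcl c d) (Omega_skew gcl eo c d).
  have ne m k : blk m != blk k -> m != k by apply: contraNneq => ->.
  split=> [/T1 h m k mk|h].
    by apply/(Omega_eq0 gcl eo c d (ne m k mk))/h; rewrite evE.
  by apply: T2 => m k; rewrite evE => mk; apply/(Omega_eq0 gcl eo c d (ne m k mk))/h.
have pairP : block_rel G blk c d -> block_pair G blk c d.
  by move=> h; split; [exact: inv | exact: inv | exact: h].
have cplx2E a b : cplx2 gam e a b = cpl G z a b
  by rewrite /cplx2 -scalemx1.
have eigenE al : Gam_eigen B gam e (tnth lam al) = subword G (in_block blk al).
  by apply: eq_bigl => m; rewrite blkE.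
have dimE al : \dim (leigenspace B (tnth lam al)) = #|in_block blk al|.
  exact: (dim_leigenspace_card e_adapted).
have formA c0 ch0 d0 dh0 :
    form_a gam e c d c0 ch0 d0 dh0 <-> coefs_a G z c d c0 ch0 d0 dh0.
  by rewrite /form_a !cplx2E.
(* The block labelled 1 belongs to the first entry of [lam], so its index is [ord0] transported to
   ['I_r]. *)
have formB (r2 : r = 2%N) c0 ch0 c1 ch1 d1 dh1 :
    form_b B gam e lam`_0 c d c0 ch0 c1 ch1 d1 dh1 <->
    coefs_b G z blk (cast_ord (esym r2) ord0) c d c0 ch0 c1 ch1 d1 dh1.
  by rewrite /form_b /coefs_b !cplx2E -eigenE (tnth_nth 0).
have formC c0 ch0 cc ch :
    form_c B gam e lam c d c0 ch0 cc ch <-> coefs_c G z blk c d c0 ch0 cc ch.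
  have eq_and (x y x' y' : 'M[R[i]]_N.+1) : x = x' -> y = y' ->
    (c = x /\ d = y <-> c = x' /\ d = y') by move=> -> ->.
  apply: eq_and.
    rewrite cplx2E; congr (_ + _); apply: eq_bigr => al _.
    by rewrite cplx2E eigenE.
  rewrite cplx2E; congr (_ + _); apply: eq_bigr => al _.
  by rewrite cplx2E eigenE dimE.
have oneblock : (exists a : R, B = a *: \1%VF) -> forall m k, blk m = blk k.
  case=> a Ba m k; apply/eqP; rewrite -evE.
  have evA j : ev j = a.
    have := B_diag j; rewrite Ba scale_lfunE id_lfunE => /eqP.
    rewrite eq_sym -subr_eq0 -scalerBl scaler_eq0 (negbTE (tnth_neq0 e_adapted j)).
    by rewrite orbF subr_eq0 => /eqP.
  by rewrite !evA.
(* The forward implications keep [hat] on the coefficients of [Gam_star], so that they serve the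
   general and the odd-dimensional statements alike. *)
have fwdA : (exists a : R, B = a *: \1%VF) -> in_soB_tensor_Cl g B (Omega gam c d) ->
    exists c0 ch0 d0 dh0, form_a gam e c d c0 (hat (\dim {:V}) ch0) d0 (hat (\dim {:V}) dh0).
  move=> Ba /tensorP/pairP; have one := oneblock Ba.
  case/(coefs_a_exist G_sqr G_anti schur z_neq0 blk_surj one).
  by move=> c0 [ch0 [d0 [dh0 h]]]; exists c0, ch0, d0, dh0; apply/formA.
have bwdA c0 ch0 d0 dh0 : (exists a : R, B = a *: \1%VF) ->
    form_a gam e c d c0 ch0 d0 dh0 -> in_soB_tensor_Cl g B (Omega gam c d).
  (* With a single eigenvalue no two basis vectors lie in different blocks. *)
  move=> Ba _; apply: (proj2 tensorP) => m k /eqP[]; exact: oneblock.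
have fwdB (r2 : r = 2%N) : in_soB_tensor_Cl g B (Omega gam c d) ->
    exists c0 ch0 c1 ch1 d1 dh1,
      form_b B gam e lam`_0 c d c0 (hat (\dim {:V}) ch0) c1 (hat (\dim {:V}) ch1) d1 (hat (\dim {:V}) dh1).
  move=> /tensorP/pairP.
  case/(coefs_b_exist G_sqr G_anti schur z_neq0 blk_surj (cast_ord (esym r2) ord0) r2).
  move=> c0 [ch0 [c1 [ch1 [d1 [dh1 h]]]]]; exists c0, ch0, c1, ch1, d1, dh1.
  exact/(formB r2).
have bwdB c0 ch0 c1 ch1 d1 dh1 : r = 2%N ->
    form_b B gam e lam`_0 c d c0 ch0 c1 ch1 d1 dh1 ->
    in_soB_tensor_Cl g B (Omega gam c d).
  by move=> r2 /(formB r2) h; apply/tensorP; apply: coefs_b_rel r2 h.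
have fwdC : (2 < r)%N -> in_soB_tensor_Cl g B (Omega gam c d) ->
    exists c0 ch0 (cc ch : 'I_r -> R[i]),
      form_c B gam e lam c d c0 (hat (\dim {:V}) ch0) cc (hat (\dim {:V}) \o ch).
  move=> r2 /tensorP/pairP.
  case/(coefs_c_exist G_sqr G_anti schur z_neq0 blk_surj r2).
  by move=> c0 [ch0 [cc [ch h]]]; exists c0, ch0, cc, ch; apply/formC.
have bwdC c0 ch0 cc ch : form_c B gam e lam c d c0 ch0 cc ch ->
    in_soB_tensor_Cl g B (Omega gam c d).
  by move=> /formC h; apply/tensorP; apply: coefs_c_rel h.
split=> [Ba|r2|r2|on].
- split; first by case/(fwdA Ba) => c0 [ch0 [d0 [dh0 h]]]; eexists _, _, _, _; exact: h.
  by case=> c0 [ch0 [d0 [dh0]]]; exact: bwdA.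
- split; last by case=> c0 [ch0 [c1 [ch1 [d1 [dh1]]]]]; exact: bwdB.
  case/(fwdB r2) => c0 [ch0 [c1 [ch1 [d1 [dh1 h]]]]].
  by eexists _, _, _, _, _, _; exact: h.
- split; last by case=> c0 [ch0 [cc [ch]]]; exact: bwdC.
  by case/(fwdC r2) => c0 [ch0 [cc [ch h]]]; eexists _, _, _, _; exact: h.
have hatE (x : R[i]) : hat (\dim {:V}) x = 0 by rewrite /hat on.
split=> [|Ba|r2|r2]; first exact: (Gam_star_odd gcl eo irr on).
- split; last by case=> c0 [d0]; exact: bwdA.
  by case/(fwdA Ba) => c0 [ch0 [d0 [dh0]]]; rewrite !hatE => h; exists c0, d0.
- split; last by case=> c0 [c1 [d1]]; exact: bwdB.
  case/(fwdB r2) => c0 [ch0 [c1 [ch1 [d1 [dh1]]]]]; rewrite !hatE => h.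
  by exists c0, c1, d1.
- split; last by case=> c0 [cc]; exact: bwdC.
  case/(fwdC r2) => c0 [ch0 [cc [ch]]]; rewrite hatE => h; exists c0, cc.
  by apply: form_c_eq_coef h => al; rewrite /= hatE.
Qed.
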